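(* (In $\mathsf{ZFC}$.) Every locally countable partial order of size continuum and height two embeds into the Turing degrees.
   Context: A partial order $(P,\leq_P)$ is locally countable if for every $x\in P$ the set $\{y\in P \mid y<_P x\}$ is countable. For a natural number $n>0$, a partial order has height $n$ if its longest chain has length exactly $n$. The Turing degrees are partially ordered by Turing reducibility $\leq_T$; an embedding of $P$ into the Turing degrees is an injective map $F$ from $P$ to the Turing degrees with $x\leq_P y \iff F(x)\leq_T F(y)$ for all $x,y\in P$. *)

(* Defs.v *)
From Stdlib Require Import List Arith.
Import ListNotations.

(* Reals = subsets of nat, given by characteristic functions. *)
Definition real := nat -> bool.

(* Codes of partial recursive functionals with an oracle (Kleene's schemes). *)
Inductive code : Type :=
| CZero : code
| CSucc : code
| CProj : nat -> code
| COracle : code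
| CComp : code -> list code -> code
| CPrim : code -> code -> code
| CMu : code -> code.

Definition b2n (b : bool) : nat := if b then 1 else 0.

Inductive eval (A : real) : code -> list nat -> nat -> Prop :=
| ev_zero v : eval A CZero v 0
| ev_succ x v : eval A CSucc (x :: v) (S x)
| ev_proj i v : i < length v -> eval A (CProj i) v (nth i v 0)
| ev_oracle x v : eval A COracle (x :: v) (b2n (A x))
| ev_comp f gs v ws y :
    evals A gs v ws -> eval A f ws y -> eval A (CComp f gs) v y
| ev_prim0 f g v y : eval A f v y -> eval A (CPrim f g) (0 :: v) y
| ev_primS f g n v r y :
    eval A (CPrim f g) (n :: v) r -> eval A g (n :: r :: v) y ->
    eval A (CPrim f g) (S n :: v) y
| ev_mu f v n :
    eval A f (n :: v) 0 ->
    (forall m, m < n -> exists k, eval A f (m :: v) (S k)) ->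
    eval A (CMu f) v n
with evals (A : real) : list code -> list nat -> list nat -> Prop :=
| evs_nil v : evals A [] v []
| evs_cons g gs v w ws :
    eval A g v w -> evals A gs v ws -> evals A (g :: gs) v (w :: ws).

Definition turing_le (A B : real) : Prop :=
  exists e : code, forall n, eval B e [n] (b2n (A n)).

Definition turing_equiv (A B : real) : Prop := turing_le A B /\ turing_le B A.

Definition is_degree (D : real -> Prop) : Prop :=
  exists A : real, forall B, D B <-> turing_equiv B A.

Definition tdegree : Type := { D : real -> Prop | is_degree D }.

Definition tdeg_le (a b : tdegree) : Prop :=
  exists A B, proj1_sig a A /\ proj1_sig b B /\ turing_le A B.

Definition partial_order {P : Type} (le : P -> P -> Prop) : Prop :=
  (forall x, le x x) /\
  (forall x y, le x y -> le y x -> x = y) /\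
  (forall x y z, le x y -> le y z -> le x z).

Definition strict {P : Type} (le : P -> P -> Prop) (x y : P) : Prop :=
  le x y /\ x <> y.

Definition countable (T : Type) : Prop :=
  exists f : T -> nat, forall a b, f a = f b -> a = b.

Definition locally_countable {P : Type} (le : P -> P -> Prop) : Prop :=
  forall x : P, countable { y : P | strict le y x }.

Definition size_continuum (P : Type) : Prop :=
  exists f : P -> real,
    (forall a b, f a = f b -> a = b) /\ (forall r, exists a, f a = r).

Definition has_chain {P : Type} (le : P -> P -> Prop) (n : nat) : Prop :=
  exists f : nat -> P, forall i j, i < j -> j < n -> strict le (f i) (f j).

Definition height {P : Type} (le : P -> P -> Prop) (n : nat) : Prop :=
  has_chain le n /\ ~ has_chain le (S n).

Definition embeds_into_degrees {P : Type} (le : P -> P -> Prop) : Prop :=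
  exists F : P -> tdegree,
    (forall x y, F x = F y -> x = y) /\
    (forall x y, le x y <-> tdeg_le (F x) (F y)).

(* Main.v *)
From Stdlib Require Import List Arith Lia FunctionalExtensionality.
From Stdlib Require Import Classical ClassicalEpsilon ProofIrrelevance.
From Stdlib Require Cantor Inverse_Image.
From mathcomp Require boolp wochoice.
Require Import Defs.
Import ListNotations.

(* Fix a perfect family of mutually generic reals [A z]. The embedding sends a
   minimal element [x] to [A (Z x)], and a non-minimal [x] to an upper bound
   [G x] of the countable set of all [A (Z y)] with [y <= x], [y = x] included.
   If [G x] computes no other [A (Z y)], then [G x <= G y] gives
   [A (Z x) <= G y], hence [x <= y]: the reals [A (Z x)] attached to the
   non-minimal elements make the upper bounds incomparable.

   For a countable set of reals [A (s i)], consider the reals whose [i]-th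
   column is [A (s i)] behind a finite generic string. A fusion argument gives
   continuum many of them such that each functional takes each value [A z]
   outside the set at most once. So a transfinite recursion of length continuum,
   choosing the indices [Z] and the bounds [G] alternately, has at each stage
   continuum many candidates and fewer than continuum many obstacles. *)

(** * Oracle computations *)

(** Induction over both relations at once, by a hand-written fixpoint, so that [ev_mu] also supplies
    the hypotheses hidden under [exists k]. *)
Lemma eval_evals_ind (A : real) (P : code -> list nat -> nat -> Prop)
    (Q : list code -> list nat -> list nat -> Prop) :
  (forall v, P CZero v 0) ->
  (forall x v, P CSucc (x :: v) (S x)) ->
  (forall i v, i < length v -> P (CProj i) v (nth i v 0)) ->
  (forall x v, P COracle (x :: v) (b2n (A x))) ->
  (forall f gs v ws y, Q gs v ws -> P f ws y -> P (CComp f gs) v y) ->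
  (forall f g v y, P f v y -> P (CPrim f g) (0 :: v) y) ->
  (forall f g n v r y, P (CPrim f g) (n :: v) r -> P g (n :: r :: v) y ->
     P (CPrim f g) (S n :: v) y) ->
  (forall f v n, P f (n :: v) 0 ->
     (forall m, m < n -> exists k, P f (m :: v) (S k)) -> P (CMu f) v n) ->
  (forall v, Q [] v []) ->
  (forall g gs v w ws, P g v w -> Q gs v ws -> Q (g :: gs) v (w :: ws)) ->
  forall c v y, eval A c v y -> P c v y.
Proof.
intros Hz Hs Hp Ho Hc H0 HS Hm Hn Hcons.
fix IH 4 with (IHs cs v ws (h : evals A cs v ws) {struct h} : Q cs v ws).
- intros c v y h; destruct h.
  + apply Hz.
  + apply Hs.
  + now apply Hp.
  + apply Ho.
  + eapply Hc; [eapply IHs; eassumption | apply IH; assumption].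
  + apply H0; apply IH; assumption.
  + eapply HS; apply IH; eassumption.
  + apply Hm; [apply IH; assumption |].
    intros m lt; destruct (H m lt) as [k hk]; exists k; apply IH; exact hk.
- intros cs v ws h; destruct h; [apply Hn | apply Hcons; [apply IH | apply IHs]; assumption].
Qed.

Lemma eval_functional A c v y y' : eval A c v y -> eval A c v y' -> y = y'.
Proof.
intro h; revert y'.
apply (eval_evals_ind A (fun c v y => forall y', eval A c v y' -> y = y')
  (fun cs v ws => forall ws', evals A cs v ws' -> ws = ws')) with (c := c) (v := v);
  auto; clear; try (intros; now inversion H).
- intros; now inversion H0.
- intros f gs v ws y IHs IH y' h; inversion h; subst.
  apply IH; now rewrite (IHs ws0).
- intros f g v y IH y' h; inversion h; subst; auto.
- intros f g n v r y IH1 IH2 y' h; inversion h; subst.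
  apply IH2; now rewrite (IH1 r0).
- intros f v n IH0 IHm y' h; inversion h as [| | | | | | |f' v' n' h0 hm]; subst.
  destruct (lt_eq_lt_dec n y') as [[lt|]|lt]; auto; exfalso.
  + destruct (hm n lt) as [k hk]; now specialize (IH0 _ hk).
  + destruct (IHm y' lt) as [k hk]; now specialize (hk _ h0).
- intros g gs v w ws IH IHs ws' h; inversion h; subst.
  f_equal; auto.
Qed.

Definition agree (u : nat) (A B : real) : Prop := forall n, n < u -> B n = A n.

(** Use principle: a halting computation queries only finitely many bits of its oracle. *)
Lemma eval_use A c v y :
  eval A c v y -> exists u, forall B, agree u A B -> eval B c v y.
Proof.
apply (eval_evals_ind A
  (fun c v y => exists u, forall B, agree u A B -> eval B c v y)
  (fun cs v ws => exists u, forall B, agree u A B -> evals B cs v ws));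
  try (intros; exists 0; intros; now constructor).
- intros x w; exists (S x); intros B h; rewrite <- h by lia; constructor.
- intros f gs w ws z [u hu] [u' hu']; exists (u + u'); intros B h.
  econstructor; [apply hu | apply hu']; intros n hn; apply h; lia.
- intros f g w z [u hu]; exists u; intros B h; constructor; auto.
- intros f g n w r z [u hu] [u' hu']; exists (u + u'); intros B h.
  econstructor; [apply hu | apply hu']; intros k hk; apply h; lia.
- intros f w n [u hu] hm.
  (* The search makes [n] unsuccessful trials; their uses are added up by induction on [n]. *)
  assert (exists u', forall B, agree u' A B ->
    forall m, m < n -> exists k, eval B f (m :: w) (S k)) as [u' hu'].
  { clear hu; induction n as [|n IH]; [exists 0; intros; lia|].
    destruct IH as [u1 h1]; [intros m lt; apply hm; lia|].
    destruct (hm n) as (k & u2 & h2); [lia|].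
    exists (u1 + u2); intros B h m lt.
    destruct (eq_nat_dec m n) as [->|ne].
    - exists k; apply h2; intros i hi; apply h; lia.
    - apply h1; [intros i hi; apply h; lia | lia]. }
  exists (u + u'); intros B h; constructor.
  + apply hu; intros i hi; apply h; lia.
  + apply hu'; intros i hi; apply h; lia.
- intros g gs w x ws [u hu] [u' hu']; exists (u + u'); intros B h.
  econstructor; [apply hu | apply hu']; intros n hn; apply h; lia.
Qed.

Definition computes (G : real) (e : code) (A : real) : Prop :=
  forall n, eval G e [n] (b2n (A n)).

Lemma b2n_inj a b : b2n a = b2n b -> a = b.
Proof. now destruct a, b. Qed.

Lemma computes_functional G e A B : computes G e A -> computes G e B -> A = B.
Proof.
intros hA hB; apply functional_extensionality; intro n.
apply b2n_inj, (eval_functional G e [n]); auto.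
Qed.

Fixpoint subst_oracle (d c : code) : code :=
  match c with
  | COracle => CComp d [CProj 0]
  | CComp f gs => CComp (subst_oracle d f) (map (subst_oracle d) gs)
  | CPrim f g => CPrim (subst_oracle d f) (subst_oracle d g)
  | CMu f => CMu (subst_oracle d f)
  | _ => c
  end.

Lemma eval_proj0 A n v : eval A (CProj 0) (n :: v) n.
Proof. apply (ev_proj A 0 (n :: v)); simpl; lia. Qed.

Lemma eval_comp1 A f g v w y :
  eval A g v w -> eval A f [w] y -> eval A (CComp f [g]) v y.
Proof. intros; econstructor; [repeat econstructor|]; eauto. Qed.

Lemma eval_subst_oracle A B d c v y :
  computes B d A -> eval A c v y -> eval B (subst_oracle d c) v y.
Proof.
intro hd.
apply (eval_evals_ind A (fun c v y => eval B (subst_oracle d c) v y)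
  (fun cs v ws => evals B (map (subst_oracle d) cs) v ws)); simpl; intros;
  try (econstructor; eassumption); try now constructor.
eapply eval_comp1; [apply eval_proj0 | apply hd].
Qed.

Lemma turing_le_refl A : turing_le A A.
Proof. exists COracle; intro n; constructor. Qed.

Lemma turing_le_trans A B C : turing_le A B -> turing_le B C -> turing_le A C.
Proof.
intros [e he] [d hd]; exists (subst_oracle d e); intro n.
now apply (eval_subst_oracle B).
Qed.

(** * Countability of codes *)

Fixpoint nat_of_list (l : list nat) : nat :=
  match l with
  | [] => 0
  | x :: l => S (Cantor.to_nat (x, nat_of_list l))
  end.

Lemma nat_of_list_inj l l' : nat_of_list l = nat_of_list l' -> l = l'.
Proof.
revert l'; induction l as [|x l IH]; intros [|x' l']; cbn [nat_of_list]; try easy.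
intros h%Nat.succ_inj%Cantor.to_nat_inj; injection h as -> h; f_equal; auto.
Qed.

Fixpoint nat_of_code (c : code) : nat :=
  match c with
  | CZero => nat_of_list [0]
  | CSucc => nat_of_list [1]
  | CProj i => nat_of_list [2; i]
  | COracle => nat_of_list [3]
  | CComp f gs =>
      nat_of_list [4; nat_of_code f; nat_of_list (map nat_of_code gs)]
  | CPrim f g => nat_of_list [5; nat_of_code f; nat_of_code g]
  | CMu f => nat_of_list [6; nat_of_code f]
  end.

Lemma code_nested_ind (P : code -> Prop) :
  P CZero -> P CSucc -> (forall i, P (CProj i)) -> P COracle ->
  (forall f gs, P f -> Forall P gs -> P (CComp f gs)) ->
  (forall f g, P f -> P g -> P (CPrim f g)) ->
  (forall f, P f -> P (CMu f)) ->
  forall c, P c.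
Proof.
intros Hz Hs Hp Ho Hc Hr Hm; fix IH 1; intros [| |i| |f gs|f g|f].
- exact Hz.
- exact Hs.
- apply Hp.
- exact Ho.
- apply Hc; [apply IH|]; induction gs as [|g gs IHgs]; constructor; [apply IH | exact IHgs].
- apply Hr; apply IH.
- apply Hm; apply IH.
Qed.

Lemma nat_of_code_inj c c' : nat_of_code c = nat_of_code c' -> c = c'.
Proof.
revert c'; induction c as [| |i| |f gs IH IHs|f g IHf IHg|f IH] using code_nested_ind;
  intros [| |i'| |f' gs'|f' g'|f'] h; cbn [nat_of_code] in h; apply nat_of_list_inj in h;
  try discriminate h; try reflexivity.
- now injection h as ->.
- injection h as h1%IH h2%nat_of_list_inj; subst; f_equal.
  revert gs' h2; induction IHs as [|g gs hg hgs IHl]; intros [|g' gs']; try discriminate;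
    auto.
  intros [= h1 h2]; f_equal; auto.
- injection h as h1 h2; f_equal; auto.
- injection h as h1; f_equal; auto.
Qed.

Lemma map_inj {X Y : Type} (f : X -> Y) :
  (forall x y, f x = f y -> x = y) -> forall l l', map f l = map f l' -> l = l'.
Proof.
intros hf; induction l as [|x l IH]; intros [|y l']; simpl; try easy.
intros [= h%hf ?]; f_equal; auto.
Qed.

(** * Columns of a real *)

(** In binary, [cp i n] is [n] followed by a zero and [i] ones, which gives a bijective pairing;
    [unp] counts the trailing ones, at one unit of fuel per digit. *)
Fixpoint cp (i n : nat) : nat :=
  match i with 0 => 2 * n | S i => S (2 * cp i n) end.

Fixpoint unp (fuel m : nat) : nat * nat :=
  match fuel with
  | 0 => (0, 0)
  | S k => if Nat.even m then (0, Nat.div2 m)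
           else let '(i, n) := unp k (Nat.div2 m) in (S i, n)
  end.

Lemma unp_cp k i n : i < k -> unp k (cp i n) = (i, n).
Proof.
revert i; induction k as [|k IH]; [lia|].
intros [|i] lt; cbn [cp unp].
- now rewrite Nat.even_even, Nat.div2_double.
- rewrite Nat.div2_succ_double, IH by lia.
  replace (Nat.even (S (2 * cp i n))) with false; auto.
  now rewrite Nat.even_succ, Nat.odd_even.
Qed.

Lemma unp_le k m : fst (unp k m) <= m /\ snd (unp k m) <= m.
Proof.
revert m; induction k as [|k IH]; intro m; simpl; [lia|].
pose proof (Nat.div2_odd m).
destruct (Nat.even m) eqn:ev; simpl; [lia|].
destruct (unp k (Nat.div2 m)) as [i n] eqn:E.
specialize (IH (Nat.div2 m)); rewrite E in IH; simpl in *.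
rewrite <- Nat.negb_even, ev in H; simpl in H; lia.
Qed.

Lemma cp_ge i n : i <= cp i n.
Proof. induction i; simpl; lia. Qed.

Definition join (a : nat -> real) : real :=
  fun m => let '(i, n) := unp (S m) m in a i n.

Lemma join_cp a i n : join a (cp i n) = a i n.
Proof. unfold join; rewrite unp_cp; auto. pose proof (cp_ge i n); lia. Qed.

(** Both coordinates of position [m] are at most [m], so a use bound [u] turns into the square of
    side [u] in the matrix of columns. *)
Lemma eval_join_use a e v y :
  eval (join a) e v y ->
  exists u, forall b, (forall i n, i < u -> n < u -> b i n = a i n) ->
    eval (join b) e v y.
Proof.
intros [u hu]%eval_use; exists u; intros b hb; apply hu; intros m hm.
unfold join; pose proof (unp_le (S m) m).
destruct (unp (S m) m) as [i n]; simpl in *; apply hb; lia.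
Qed.

Definition prepend (t : list bool) (a : real) : real :=
  fun n => if n <? length t then nth n t false else a (n - length t).

Lemma prepend_length t a n : prepend t a (length t + n) = a n.
Proof.
unfold prepend; destruct (Nat.ltb_spec (length t + n) (length t)); [lia|].
f_equal; lia.
Qed.

Lemma prepend_agree u t a b : agree u a b -> agree u (prepend t a) (prepend t b).
Proof.
intros h n hn; unfold prepend; destruct (Nat.ltb_spec n (length t)); auto.
apply h; lia.
Qed.

Definition double_code : code := CPrim CZero (CComp CSucc [CComp CSucc [CProj 1]]).

Lemma eval_double A n : eval A double_code [n] (2 * n).
Proof.
induction n as [|n IH]; [repeat constructor|].
eapply ev_primS; [exact IH|].
replace (2 * S n) with (S (S (2 * n))) by lia.
eapply eval_comp1; [|constructor].
eapply eval_comp1; [|constructor].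
apply (ev_proj A 1 [n; 2 * n]); simpl; lia.
Qed.

Fixpoint cp_code (i : nat) : code :=
  match i with
  | 0 => double_code
  | S i => CComp CSucc [CComp double_code [cp_code i]]
  end.

Lemma eval_cp A i n : eval A (cp_code i) [n] (cp i n).
Proof.
induction i as [|i IH]; [apply eval_double|].
eapply eval_comp1; [eapply eval_comp1; [exact IH | apply eval_double]|constructor].
Qed.

Fixpoint add_code (t : nat) : code :=
  match t with 0 => CProj 0 | S t => CComp CSucc [add_code t] end.

Lemma eval_add A t n : eval A (add_code t) [n] (t + n).
Proof.
induction t as [|t IH]; [apply eval_proj0|].
eapply eval_comp1; [exact IH | constructor].
Qed.

(** The code skips the [length t] leading bits of column [i]. It depends only on [i] and [t], hence
    serves all [a] and [b] at once. *)
Lemma column_computable i t :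
  exists e, forall a b, a i = prepend t b -> computes (join a) e b.
Proof.
exists (CComp COracle [CComp (cp_code i) [add_code (length t)]]); intros a b h n.
eapply eval_comp1; [eapply eval_comp1; [apply eval_add | apply eval_cp]|].
replace (b n) with (join a (cp i (length t + n))); [constructor|].
now rewrite join_cp, h, prepend_length.
Qed.

(** An injective pairing of reals with numbers: one label [c] chosen at a stage yields the countably
    many indices [tag c n]. *)
Definition tag (c : real) (n : nat) : real :=
  join (fun i => match i with 0 => c | _ => Nat.eqb n end).

Lemma tag_inj c n c' n' : tag c n = tag c' n' -> c = c' /\ n = n'.
Proof.
intro h.
assert (H : forall i k, tag c n (cp i k) = tag c' n' (cp i k)) by now rewrite h.
unfold tag in H; setoid_rewrite join_cp in H; split.
- apply functional_extensionality; exact (H 0).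
- specialize (H 1 n'); simpl in H; rewrite Nat.eqb_refl in H.
  now apply Nat.eqb_eq.
Qed.
(** * Perfect sets of mutually generic sequences *)

Definition ext {B : Type} (p q : list B) : Prop := exists s, q = p ++ s.

Definition restr {B : Type} (f : nat -> B) (l : nat) : list B := map f (seq 0 l).

Definition initial {B : Type} (p : list B) (f : nat -> B) : Prop :=
  p = restr f (length p).

Lemma ext_refl {B : Type} (p : list B) : ext p p.
Proof. exists []; now rewrite app_nil_r. Qed.

Lemma ext_trans {B : Type} (p q r : list B) : ext p q -> ext q r -> ext p r.
Proof. intros [s ->] [t ->]; exists (s ++ t); now rewrite app_assoc. Qed.

Lemma ext_length {B : Type} (p q : list B) : ext p q -> length p <= length q.
Proof. intros [s ->]; rewrite length_app; lia. Qed.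

Lemma ext_nth {B : Type} (p q : list B) i d :
  ext p q -> i < length p -> nth i q d = nth i p d.
Proof. intros [s ->] lt; now rewrite app_nth1. Qed.

Lemma restr_length {B : Type} (f : nat -> B) l : length (restr f l) = l.
Proof. unfold restr; now rewrite length_map, length_seq. Qed.

Lemma restr_nth {B : Type} (f : nat -> B) l i d : i < l -> nth i (restr f l) d = f i.
Proof.
intro lt; rewrite nth_indep with (d' := f 0) by now rewrite restr_length.
unfold restr; now rewrite map_nth, seq_nth.
Qed.

Lemma initial_nth {B : Type} (p : list B) f i d :
  initial p f -> i < length p -> nth i p d = f i.
Proof. intros h lt; rewrite h; now apply restr_nth. Qed.

Lemma nth_initial {B : Type} (p : list B) f d :
  (forall i, i < length p -> nth i p d = f i) -> initial p f.
Proof.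
intro h; apply nth_ext with (d := d) (d' := d); [now rewrite restr_length|].
intros i lt; rewrite restr_nth; auto.
Qed.

Lemma initial_ext {B : Type} (p : list B) f l :
  initial p f -> length p <= l -> ext p (restr f l).
Proof.
intros h le; rewrite h; exists (map f (seq (length p) (l - length p))).
unfold restr; rewrite <- map_app, <- seq_app; do 2 f_equal; lia.
Qed.

Lemma ext_initial {B : Type} (p q : list B) f : ext p q -> initial q f -> initial p f.
Proof.
intros e h; destruct p as [|b p]; [reflexivity|].
apply nth_initial with (d := b); intros i lt.
rewrite <- (ext_nth _ _ _ _ e lt); apply initial_nth; auto.
apply ext_length in e; lia.
Qed.

Lemma removelast_restr {B : Type} (f : nat -> B) l :
  removelast (restr f (S l)) = restr f l.
Proof. unfold restr; rewrite seq_S, map_app; apply removelast_last. Qed.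

Fixpoint tuples {X : Type} (k : nat) (L : list X) : list (list X) :=
  match k with
  | 0 => [[]]
  | S k => [] :: flat_map (fun x => map (cons x) (tuples k L)) L
  end.

Lemma in_tuples {X : Type} k (L l : list X) :
  incl l L -> length l <= k -> In l (tuples k L).
Proof.
revert l; induction k as [|k IH]; intros [|x l] hL hk; simpl in *; auto; [lia|].
right; apply in_flat_map; exists x; split; [apply hL; now left|].
apply in_map, IH; [|lia]; intros y hy; apply hL; now right.
Qed.

Lemma incl_bool_tuples l (L : list (list bool)) :
  (forall s, In s L -> length s = l) -> incl L (tuples l [true; false]).
Proof.
intros h s hs; apply in_tuples; [|now rewrite h].
intros [] _; simpl; auto.
Qed.

(** Lets the fusion move one tuple of tree nodes and keep all others; distinctness of [ts] makes the
    new values consistent. *)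
Lemma prescribe {X Y : Type} (N : X -> Y) ts : NoDup ts -> forall qs,
  length qs = length ts ->
  exists N', map N' ts = qs /\ forall s, ~ In s ts -> N' s = N s.
Proof.
induction ts as [|t ts IH]; intros hd [|q qs]; try easy.
- now exists N.
- intros [= hl]; inversion hd as [|? ? ht hts]; subst.
  destruct (IH hts qs hl) as (N' & h1 & h2).
  exists (fun s => if excluded_middle_informative (s = t) then q else N' s); split.
  + simpl; destruct excluded_middle_informative as [_|]; [|easy]; f_equal.
    rewrite <- h1; apply map_ext_in; intros s hs.
    destruct excluded_middle_informative; congruence.
  + intros s hs; simpl in hs; destruct excluded_middle_informative as [->|];
      [tauto | apply h2; tauto].
Qed.

Lemma Forall2_map_in {X Y : Type} (R : Y -> Y -> Prop) (f g : X -> Y) l :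
  Forall2 R (map f l) (map g l) -> forall x, In x l -> R (f x) (g x).
Proof.
induction l as [|y l IH]; simpl; [easy|].
intros h; inversion h; subst; intros x [<-|hx]; auto.
Qed.

Lemma Forall2_map_map {X Y Z : Type} (R : Y -> Z -> Prop) (f : X -> Y) (g : X -> Z) l :
  (forall x, In x l -> R (f x) (g x)) -> Forall2 R (map f l) (map g l).
Proof. induction l; simpl; constructor; auto. Qed.

Lemma restr_separates (rs : list real) : NoDup rs ->
  exists l0, forall l, l0 <= l -> NoDup (map (fun r : real => restr r l) rs).
Proof.
intro hd; induction hd as [|r rs hr hd [l0 IH]]; [exists 0; constructor|].
assert (exists l1, forall l, l1 <= l -> ~ In (restr r l) (map (fun r : real => restr r l) rs))
  as [l1 h1].
{ clear -hr; induction rs as [|r' rs IH]; [exists 0; auto|].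
  destruct IH as [l1 h1]; [intro; apply hr; now right|].
  assert (exists n, r' n <> r n) as [n hn].
  { apply not_all_ex_not; intro h; apply hr; left.
    now apply functional_extensionality. }
  exists (l1 + S n); intros l hl [h|h]; [|apply (h1 l); auto; lia].
  apply hn; rewrite <- (restr_nth r' l n false), h by lia; apply restr_nth; lia. }
exists (l0 + l1); intros l hl; simpl; constructor; [apply h1 | apply IH]; lia.
Qed.

(* Mycielski: a fusion along the binary tree; at level [l] the finitely many
   tuples of distinct nodes are moved into the first [l] dense open sets. *)
Lemma mycielski (B : Type) (b0 : B) (D : nat -> list (list B) -> Prop) :
  (forall m p q, D m p -> Forall2 ext p q -> D m q) ->
  (forall m p, exists q, Forall2 ext p q /\ D m q) ->
  exists f : real -> nat -> B, forall m rs, NoDup rs ->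
    exists ps, Forall2 initial ps (map f rs) /\ D m ps.
Proof.
intros Dopen Ddense.
pose (le := fun N N' : list bool -> list B => forall s, ext (N s) (N' s)).
assert (le_D : forall m N N' ts, le N N' -> D m (map N ts) -> D m (map N' ts)).
{ intros m N N' ts h hD; eapply Dopen; [exact hD|].
  apply Forall2_map_map; auto. }
assert (step1 : forall N m ts, NoDup ts -> exists N', le N N' /\ D m (map N' ts)).
{ intros N m ts hd; destruct (Ddense m (map N ts)) as (q & hq & hD).
  destruct (prescribe N ts hd q) as (N' & <- & hN).
  { apply Forall2_length in hq; now rewrite length_map in hq. }
  exists N'; split; auto; intro s.
  destruct (classic (In s ts)) as [hs|hs].
  - now apply (Forall2_map_in _ _ _ _ hq).
  - rewrite hN by auto; apply ext_refl. }
(* Tasks are met one after another; openness, in the form [le_D], preserves those already met. *)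
assert (step2 : forall tasks N, exists N', le N N' /\
  forall m ts, In (m, ts) tasks -> NoDup ts -> D m (map N' ts)).
{ induction tasks as [|[m ts] tasks IH]; intro N.
  - exists N; split; [intro; apply ext_refl | easy].
  - destruct (IH N) as (N1 & h1 & h2).
    destruct (classic (NoDup ts)) as [hd|hd].
    + destruct (step1 N1 m ts hd) as (N2 & h3 & h4); exists N2; split.
      * intro s; eapply ext_trans; [apply h1 | apply h3].
      * intros m' ts' [[= <- <-]|h] hd'; auto.
        apply (le_D _ _ _ _ h3); auto.
    + exists N1; split; auto; intros m' ts' [[= <- <-]|h] hd'; [easy | auto]. }
(* Appending [b0] before treating the tasks of a level makes every node grow, so that branches
   become infinite. *)
assert (step3 : forall x : nat * (list bool -> list B), exists N',
  (forall s, ext (snd x s ++ [b0]) (N' s)) /\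
  forall m ts, m <= fst x -> length ts <= fst x -> NoDup ts ->
    (forall s, In s ts -> length s = fst x) -> D m (map N' ts)).
{ intros [l N]; simpl.
  destruct (step2 (list_prod (seq 0 (S l)) (tuples l (tuples l [true; false])))
    (fun s => N s ++ [b0])) as (N' & h1 & h2).
  exists N'; split; auto; intros m ts hm hl hd hs.
  apply h2; auto; apply in_prod; [apply in_seq; lia|].
  apply in_tuples; auto; now apply incl_bool_tuples. }
destruct (choice _ step3) as [nxt hnxt]; clear step1 step2 step3.
(* A node of level [S l] starts from the condition of its parent [removelast s]. *)
pose (Ns := fix Ns l := match l with
  | 0 => fun _ => []
  | S l => nxt (S l, fun s => Ns l (removelast s)) end).
pose (node := fun (r : real) l => Ns l (restr r l)).
assert (node_S : forall r l, ext (node r l ++ [b0]) (node r (S l))).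
{ intros r l; unfold node at 2; cbn [Ns].
  destruct (hnxt (S l, fun s => Ns l (removelast s))) as [h _].
  specialize (h (restr r (S l))); cbn [snd] in h; now rewrite removelast_restr in h. }
assert (node_le : forall r l l', l <= l' -> ext (node r l) (node r l')).
{ intros r l l' h; induction h as [|l' h IH]; [apply ext_refl|].
  eapply ext_trans; [exact IH|]; eapply ext_trans; [|apply node_S].
  now exists [b0]. }
assert (node_length : forall r l, l <= length (node r l)).
{ intros r l; induction l as [|l IH]; [lia|].
  pose proof (ext_length _ _ (node_S r l)) as h.
  rewrite length_app in h; simpl in h; lia. }
(* The node at level [S n] has an [n]-th entry, so the default [b0] is never read. *)
exists (fun r n => nth n (node r (S n)) b0); intros m rs hd.
destruct (restr_separates rs hd) as [l0 hl0].
(* High enough to separate [rs] and to have treated index [m] and tuples of length [length rs]; a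
   successor, so that [Ns l] unfolds to [nxt]. *)
pose (l := S (l0 + m + length rs)).
exists (map (fun r => node r l) rs); split.
- apply Forall2_map_map; intros r _.
  apply nth_initial with (d := b0); intros i lt.
  destruct (le_ge_dec l (S i)) as [h|h].
  + symmetry; apply ext_nth; auto.
  + apply ext_nth; auto; pose proof (node_length r (S i)); lia.
- replace (map (fun r => node r l) rs) with (map (Ns l) (map (fun r : real => restr r l) rs))
    by apply map_map.
  change (Ns l) with (nxt (l, fun s => Ns (l0 + m + length rs) (removelast s))).
  apply hnxt; cbn [fst]; rewrite ?length_map; try (unfold l; lia).
  + apply hl0; unfold l; lia.
  + intros s [r [<- _]]%in_map_iff; apply restr_length.
Qed.
(** * The independent family and the upper bounds *)

Definition zero : real := fun _ => false.

Definition starts_with (cols : nat -> real) (t : list (list bool)) (bs : list real) : Prop :=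
  forall i, i < length t -> cols i = prepend (nth i t []) (nth i bs zero).

(* If [e] computes [A] from some real whose first columns are finite shifts of
   [bs], then on another such real it gives a wrong value: [A] is not forced by [bs]. *)
Definition unforced (e : code) (t : list (list bool)) (bs : list real) (A : real) : Prop :=
  (exists cols, starts_with cols t bs /\ computes (join cols) e A) ->
  exists cols n y, starts_with cols t bs /\ eval (join cols) e [n] y /\ y <> b2n (A n).

(** Lists of columns may repeat a real, whereas the fusion handles distinct reals only; the indices
    [js] record the repetitions. *)
Definition select (js : list nat) (l : list real) : list real :=
  map (fun j => nth j l zero) js.

Lemma nth_select i js l :
  exists j, forall k, nth i (select js l) zero = nth j l zero /\
    nth i (select js k) zero = nth j k zero \/
    nth i (select js l) zero = zero /\ nth i (select js k) zero = zero.
Proof.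
revert i; induction js as [|j js IH]; intros [|i]; simpl;
  [exists 0; auto | exists 0; auto | exists j; auto | apply IH].
Qed.

Lemma agree_select u i js l k :
  (forall j, agree u (nth j l zero) (nth j k zero)) ->
  agree u (nth i (select js l) zero) (nth i (select js k) zero).
Proof.
intro h; destruct (nth_select i js l) as [j hj].
destruct (hj k) as [[-> ->]|[-> ->]]; [apply h | intros n _; reflexivity].
Qed.

Lemma agree_conditions u ps l : Forall2 initial ps l ->
  exists qs, Forall2 ext ps qs /\ forall k, Forall2 initial qs k ->
    forall j, agree u (nth j l zero) (nth j k zero).
Proof.
intro h; induction h as [|p a ps l hp h (qs & h1 & h2)].
- exists []; split; [constructor|]; intros k hk; inversion hk; subst.
  intros j n _; reflexivity.
- exists (restr a (u + length p) :: qs); split.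
  + constructor; auto; apply initial_ext; auto; lia.
  + intros k hk; inversion hk as [|? a' ? k' ha hk']; subst.
    intros [|j]; simpl; [|now apply h2].
    intros n hn; rewrite <- (initial_nth _ _ n false ha), restr_nth;
      rewrite ?restr_length; auto; lia.
Qed.

Definition bit_other (y : nat) : bool := match y with 0 => true | _ => false end.

Lemma bit_other_neq y : y <> b2n (bit_other y).
Proof. now destruct y. Qed.

Definition ensures_unforced (e : code) (t : list (list bool)) (js : list nat)
    (p : list (list bool)) : Prop :=
  match p with
  | [] => True
  | x :: xs => forall A l, initial x A -> Forall2 initial xs l ->
      unforced e t (select js l) A
  end.

(** Position [length x] is the first that [x] leaves open. If some admissible columns make [e]
    converge there, freezing the use and setting that bit to differ from the output yields a wrong
    value. If none do, [e] never computes [A], and [unforced] holds vacuously. *)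
Lemma unforced_dense e t js p :
  exists q, Forall2 ext p q /\ ensures_unforced e t js q.
Proof.
destruct p as [|x xs]; [exists []; split; [constructor | exact I]|].
destruct (classic (exists l cols y, Forall2 initial xs l /\
  starts_with cols t (select js l) /\ eval (join cols) e [length x] y))
  as [(l & cols & y & hl & hc & hy)|none].
- destruct (eval_join_use _ _ _ _ hy) as [u hu].
  destruct (agree_conditions u xs l hl) as (qs & h1 & h2).
  exists ((x ++ [bit_other y]) :: qs); split.
  + constructor; auto; eexists; reflexivity.
  + intros A l' hA hl' _.
    exists (fun i => if i <? length t
      then prepend (nth i t []) (nth i (select js l') zero) else cols i).
    exists (length x), y; split; [|split].
    * intros i hi; now apply Nat.ltb_lt in hi as ->.
    * apply hu; intros i n hi hn; destruct (Nat.ltb_spec i (length t)) as [lt|]; auto.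
      rewrite (hc i lt); revert n hn; apply prepend_agree, agree_select; auto.
    * rewrite <- (initial_nth _ _ (length x) false hA)
        by (rewrite length_app; simpl; lia).
      rewrite app_nth2, Nat.sub_diag by lia; apply bit_other_neq.
- exists (x :: xs); split.
  + clear; induction (x :: xs); constructor; auto using ext_refl.
  + intros A l hA hl (cols & h1 & h2); destruct none; eauto 6.
Qed.

Lemma unforced_open e t js p q : Forall2 ext p q ->
  ensures_unforced e t js p -> ensures_unforced e t js q.
Proof.
intros h; destruct h as [|x y xs ys hx hxs]; auto.
intros H A l hA hl; apply H; [now apply (ext_initial _ y)|].
clear -hxs hl; revert l hl; induction hxs as [|x y xs ys hx hxs IH];
  intros l hl; inversion hl; subst; constructor; auto.
now apply (ext_initial _ y).
Qed.

Lemma map_select (A : real -> real) (ws zs : list real) :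
  incl ws zs -> exists js, map A ws = select js (map A zs).
Proof.
induction ws as [|w ws IH]; intro h; [now exists []|].
destruct IH as [js hjs]; [intros x hx; apply h; now right|].
destruct (In_nth (map A zs) (A w) zero) as (j & _ & hj);
  [apply in_map, h; now left|].
exists (j :: js); simpl; unfold select in *; now rewrite hjs, hj.
Qed.

Definition independent (A : real -> real) : Prop :=
  forall e t ws z, ~ In z ws -> unforced e t (map A ws) (A z).

Definition nat_of_task (x : code * list (list bool) * list nat) : nat :=
  let '(e, t, js) := x in
  nat_of_list [nat_of_code e; nat_of_list (map (fun s => nat_of_list (map b2n s)) t);
               nat_of_list js].

Lemma nat_of_task_inj x y : nat_of_task x = nat_of_task y -> x = y.
Proof.
destruct x as [[e t] js], y as [[e' t'] js']; intro h; apply nat_of_list_inj in h.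
injection h as h1%nat_of_code_inj h2%nat_of_list_inj h3%nat_of_list_inj; subst.
do 2 f_equal; apply map_inj in h2; auto.
intros s s' h%nat_of_list_inj; now apply map_inj in h; [|apply b2n_inj].
Qed.

(** There is one dense open set for each triple of a code, finite shifts and indices; numbers that
    code no triple impose nothing. *)
Lemma independent_family : exists A, independent A.
Proof.
destruct (mycielski bool false (fun m p => forall e t js, nat_of_task (e, t, js) = m ->
  ensures_unforced e t js p)) as [A hA].
- intros m p q H h e t js E; apply (unforced_open e t js p q h), H, E.
- intros m p; destruct (classic (exists x, nat_of_task x = m)) as [[[[e t] js] E]|none].
  + destruct (unforced_dense e t js p) as (q & h1 & h2); exists q; split; auto.
    intros e' t' js' E'; rewrite <- E in E'; apply nat_of_task_inj in E'.
    now injection E' as -> -> ->.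
  + exists p; split; [clear; induction p; constructor; auto using ext_refl|].
    intros e t js E; destruct none; eauto.
- exists A; intros e t ws z hz.
  (* The fusion needs distinct reals: duplicates in [ws] are removed here and restored through
     [js]. *)
  pose (zs := nodup (fun a b => excluded_middle_informative (a = b)) ws).
  destruct (map_select A ws zs) as [js ->]; [intros w hw; now apply nodup_In|].
  destruct (hA (nat_of_task (e, t, js)) (z :: zs)) as (ps & h1 & h2).
  { constructor; [|apply NoDup_nodup]; intro h; now apply nodup_In in h. }
  inversion h1; subst; now apply (h2 e t js).
Qed.

(** If distinct [z] and [w] gave the same real, reading off column 0, filled with [A w], would
    compute [A z] from every admissible real, so [A z] would be forced. *)
Lemma independent_inj A : independent A -> forall z w, A z = A w -> z = w.
Proof.
intros h z w E; apply NNPP; intro ne.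
destruct (column_computable 0 []) as [e he].
destruct (h e [[]] [w] z) as (cols & n & y & h1 & h2 & h3).
- intros [h'|[]]; now apply ne.
- exists (fun _ => prepend [] (A w)); split.
  + intros [|i] hi; simpl in *; [reflexivity | lia].
  + rewrite E; now apply he.
- apply h3; rewrite E; apply (eval_functional _ _ _ _ _ h2).
  now apply he, (h1 0); simpl; lia.
Qed.

(** * Upper bounds of countable families *)

Definition shifted (a : nat -> real) (t : nat -> list bool) : nat -> real :=
  fun i => prepend (t i) (a i).

Lemma shifted_starts_with a t p :
  initial p t -> starts_with (shifted a t) p (map a (seq 0 (length p))).
Proof.
intros h i hi; unfold shifted.
change (map a (seq 0 (length p))) with (restr a (length p)).
now rewrite restr_nth, (initial_nth _ _ _ _ h).
Qed.

(** Columns not yet committed may start with any finite string. Giving each of the next [u] columns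
    the first [u] bits of [cols] reproduces the whole square that a computation can see. *)
Lemma shifted_approx a cols p u :
  starts_with cols p (map a (seq 0 (length p))) ->
  exists q, ext p q /\ forall t, initial q t ->
    forall i n, i < u -> n < u -> shifted a t i n = cols i n.
Proof.
intro h; set (k := length p) in *.
exists (p ++ map (fun i => restr (cols i) u) (seq k u)); split; [eexists; reflexivity|].
intros t ht i n hi hn; unfold shifted.
rewrite <- (initial_nth _ _ i [] ht)
  by (rewrite length_app, length_map, length_seq; lia).
destruct (le_lt_dec k i) as [ge|lt].
- rewrite app_nth2 by auto.
  rewrite nth_indep with (d' := restr (cols 0) u)
    by (rewrite length_map, length_seq; lia).
  rewrite (map_nth (fun i => restr (cols i) u)), seq_nth by lia.
  fold k; replace (k + (i - k)) with i by lia.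
  unfold prepend; rewrite restr_length.
  destruct (Nat.ltb_spec n u); [|lia]; now rewrite restr_nth.
- rewrite app_nth1 by auto; rewrite (h i lt).
  change (map a (seq 0 k)) with (restr a k); now rewrite restr_nth.
Qed.

(* The binary fusion: as long as two conditions do not already exclude a common
   value [A z], independence of [A z] over the committed columns yields two
   extensions with different values. *)
Lemma upper_bounds A (s : nat -> real) : independent A ->
  exists G : real -> real,
    (forall r i, turing_le (A (s i)) (G r)) /\
    (forall e z r r', (forall i, s i <> z) ->
       computes (G r) e (A z) -> computes (G r') e (A z) -> r = r').
Proof.
intro ind; pose (a := fun i => A (s i)).
pose (bad := fun e t0 t1 => exists z, (forall i, s i <> z) /\
  computes (join (shifted a t0)) e (A z) /\ computes (join (shifted a t1)) e (A z)).
(* A condition is a finite sequence of strings, the shifts committed so far. Only pairs of branches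
   are controlled; tuples of other lengths carry no requirement. *)
destruct (mycielski (list bool) [] (fun m p => forall e, nat_of_code e = m ->
  match p with
  | [p0; p1] => forall t0 t1, initial p0 t0 -> initial p1 t1 -> ~ bad e t0 t1
  | _ => True
  end)) as [f hf].
- intros m p q H h e E; specialize (H e E).
  destruct h as [|p0 q0 ? ? h0 [|p1 q1 ? ? h1 []]]; auto.
  intros t0 t1 i0 i1; apply H; eapply ext_initial; eauto.
- intros m p; destruct (classic (exists e, nat_of_code e = m)) as [[e E]|none].
  2:{ exists p; split; [clear; induction p; constructor; auto using ext_refl|].
      intros e E; destruct none; eauto. }
  enough (exists q, Forall2 ext p q /\ match q with
    | [p0; p1] => forall t0 t1, initial p0 t0 -> initial p1 t1 -> ~ bad e t0 t1
    | _ => True end) as (q & h1 & h2).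
  { exists q; split; auto; intros e' E'; rewrite <- E in E'.
    now apply nat_of_code_inj in E' as ->. }
  assert (triv : forall p : list (list (list bool)), Forall2 ext p p)
    by (clear; induction p; constructor; auto using ext_refl).
  destruct p as [|p0 [|p1 [|]]];
    try (eexists; split; [apply triv | exact I]).
  destruct (classic (exists t0 t1, initial p0 t0 /\ initial p1 t1 /\ bad e t0 t1))
    as [(t0 & t1 & i0 & i1 & z & hz & c0 & c1)|none].
  2:{ exists [p0; p1]; split; [apply triv|]; intros t0 t1 i0 i1 b; apply none; eauto. }
  destruct (ind e p0 (map s (seq 0 (length p0))) z) as (cols & n & y & h1 & h2 & h3).
  { intros [i [hi _]]%in_map_iff; now apply (hz i). }
  { exists (shifted a t0); split; auto.
    rewrite map_map; now apply shifted_starts_with. }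
  rewrite map_map in h1.
  destruct (eval_join_use _ _ _ _ h2) as [u hu].
  destruct (eval_join_use _ _ _ _ (c1 n)) as [u' hu'].
  destruct (shifted_approx a cols p0 u h1) as (q0 & e0 & k0).
  (* The left condition fixes the output [y] at [n], the right one the output [A z n]. A common
     value [A z'] would make the two equal. *)
  exists [q0; restr t1 (u' + length p1)]; split.
  + constructor; auto; constructor; auto; apply initial_ext; auto; lia.
  + intros t0' t1' j0 j1 (z' & _ & d0 & d1); apply h3.
    assert (v0 : y = b2n (A z' n)).
    { apply (eval_functional (join (shifted a t0')) e [n]); [|apply d0].
      apply hu; now apply k0. }
    assert (v1 : b2n (A z n) = b2n (A z' n)).
    { apply (eval_functional (join (shifted a t1')) e [n]); [|apply d1].
      apply hu'; intros i k hi hk; unfold shifted.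
      rewrite <- (initial_nth _ _ i [] j1), restr_nth; rewrite ?restr_length; auto; lia. }
    congruence.
- exists (fun r => join (shifted a (f r))); split.
  + intros r i; destruct (column_computable i (f r i)) as [e he]; exists e.
    now apply he.
  + intros e z r r' hz c0 c1; apply NNPP; intro ne.
    destruct (hf (nat_of_code e) [r; r']) as (ps & h1 & h2).
    { repeat constructor; simpl; intuition congruence. }
    inversion h1 as [|p0 ? ps' ? i0 h1']; subst; inversion h1' as [|p1 ? ps ? i1 h1'']; subst.
    inversion h1''; subst.
    apply (h2 e eq_refl (f r) (f r') i0 i1); exists z; auto.
Qed.
(** * Choosing the degrees *)

Lemma well_ordering (T : Type) :
  exists lt : T -> T -> Prop, well_founded lt /\
    forall x y, lt x y \/ x = y \/ lt y x.
Proof.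
destruct (wochoice.well_ordering_principle
  (boolp.boolp_classicType__canonical__eqtype_Equality T)) as [R wo].
change (T -> T -> bool) in R.
assert (min : forall S : T -> Prop, (exists x, S x) ->
  exists z, S z /\ (forall x, S x -> R z x = true) /\
    forall z', S z' -> (forall x, S x -> R z' x = true) -> z = z').
{ intros S [x hx].
  pose (A := fun x : T => if excluded_middle_informative (S x) then true else false).
  assert (hA : forall x, A x = true <-> S x)
    by (intro y; unfold A; destruct excluded_middle_informative; intuition discriminate).
  destruct (wo A) as (z & [h1 h2] & h3).
  - exists x; apply hA, hx.
  - exists z; split; [apply hA, h1 | split].
    + intros y hy; apply h2, hA, hy.
    + intros z' hz' hm; apply h3; split; [apply hA, hz'|].
      intros y hy; apply hm, hA, hy. }
assert (antisym : forall x y, R x y = true -> R y x = true -> x = y).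
{ assert (refl : forall x, R x x = true).
  { intro x; destruct (min (eq x)) as (z & <- & h & _); eauto. }
  intros x y h1 h2.
  (* Both [x] and [y] are least in this set, and least elements are unique. *)
  destruct (min (fun z => z = x \/ z = y)) as (z & _ & _ & h); [eauto|].
  transitivity z; [symmetry|]; apply h; auto; intros ? [->| ->]; auto. }
exists (fun x y => R x y = true /\ x <> y); split.
- intro x; apply NNPP; intro hx.
  destruct (min (fun x => ~ Acc (fun x y => R x y = true /\ x <> y) x))
    as (z & hz & h & _); [eauto|].
  apply hz; constructor; intros y [h1 h2]; apply NNPP; intro hy.
  apply h2, antisym; auto.
- intros x y; destruct (classic (x = y)) as [|ne]; auto.
  destruct (min (fun z => z = x \/ z = y)) as (z & [->| ->] & h & _); [eauto| |];
    auto 6.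
Qed.

Lemma wf_min {W : Type} (lt : W -> W -> Prop) (S : W -> Prop) :
  well_founded lt -> (exists w, S w) -> exists w, S w /\ forall v, lt v w -> ~ S v.
Proof.
intros wf [w hw]; apply NNPP; intro none; revert hw.
induction (wf w) as [w _ IH]; intro hw; apply none; exists w; split; auto.
Qed.

(* A well-order of least length among those that map onto the continuum. *)
Lemma short_well_order :
  exists (W : Type) (lt : W -> W -> Prop) (g : W -> real),
    well_founded lt /\ (forall v w, lt v w \/ v = w \/ lt w v) /\
    (forall r, exists w, g w = r) /\
    forall w (h : W -> real), exists r, forall v, lt v w -> h v <> r.
Proof.
destruct (well_ordering real) as (lt & wf & tri).
(* The predecessors of [a] already map onto the continuum. A least such [a] cuts off the order
   wanted; if there is none, all of [real] serves. *)
pose (big := fun a => exists h : real -> real, forall r, exists v, lt v a /\ h v = r).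
destruct (classic (exists a, big a)) as [ex|none].
- destruct (wf_min lt big wf ex) as (a & [h hh] & amin).
  exists {v | lt v a}, (fun v w => lt (proj1_sig v) (proj1_sig w)),
    (fun v => h (proj1_sig v)); split; [|split; [|split]].
  + apply (Inverse_Image.wf_inverse_image _ _ lt), wf.
  + intros [v hv] [w hw]; simpl.
    destruct (tri v w) as [|[->|]]; auto.
    right; left; f_equal; apply proof_irrelevance.
  + intro r; destruct (hh r) as (v & hv & <-); now exists (exist _ v hv).
  + intros [w hw] k; apply NNPP; intro no; apply (amin w hw).
    exists (fun v => match excluded_middle_informative (lt v a) with
      | left hv => k (exist _ v hv) | right _ => zero end); intro r.
    apply NNPP; intro nr; apply no; exists r; intros [v hv] lvw E.
    apply nr; exists v; split; [exact lvw|].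
    destruct excluded_middle_informative as [hv'|]; [|easy].
    now rewrite (proof_irrelevance _ hv' hv).
- exists real, lt, (fun r => r); split; [|split; [|split]]; eauto.
  intros w h; apply NNPP; intro no; apply none; exists w, h; intro r.
  apply NNPP; intro nr; apply no; exists r; eauto.
Qed.

(** Well-founded recursion with a choice at each stage. [R] depends only on earlier values, so the
    filler [y0] elsewhere is harmless. *)
Lemma transfinite_choice {W Y : Type} (lt : W -> W -> Prop) (y0 : Y)
    (R : W -> (W -> Y) -> Y -> Prop) :
  well_founded lt ->
  (forall w g, exists y, R w g y) ->
  (forall w g g' y, (forall v, lt v w -> g v = g' v) -> R w g y -> R w g' y) ->
  exists f, forall w, R w f (f w).
Proof.
intros wf ex loc.
pose (past := fun w (prev : forall v, lt v w -> Y) v =>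
  match excluded_middle_informative (lt v w) with
  | left h => prev v h | right _ => y0 end).
pose (F := fun w prev =>
  proj1_sig (constructive_indefinite_description _ (ex w (past w prev)))).
exists (Fix wf (fun _ => Y) F); intro w; rewrite Fix_eq.
- apply (loc w (past w (fun v _ => Fix wf (fun _ => Y) F v))).
  + intros v h; unfold past; now destruct excluded_middle_informative.
  + exact (proj2_sig (constructive_indefinite_description _ _)).
- intros x f g E; replace g with f; auto.
  do 2 (apply functional_extensionality_dep; intro); apply E.
Qed.

(* König's argument: countably many sets, each too small to project onto the
   continuum, cannot cover the product of countably many copies of it. *)
Lemma avoid_small {W : Type} (V : W -> Prop) (B : W -> nat -> real -> Prop) :
  (forall h : W -> real, exists r, forall v, V v -> h v <> r) ->
  (forall v m b b', B v m b -> B v m b' -> b = b') ->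
  exists b, forall v m, V v -> ~ B v m b.
Proof.
intros small uniq.
(* Each [B v m] forbids at most one real, so the forbidden [m]-th columns are indexed by [V] and
   miss some [r], which becomes column [m] of the join. *)
assert (H : forall m, exists r : real, forall v b, V v -> B v m b ->
  (fun n => b (cp m n)) <> r).
{ intro m.
  destruct (small (fun v => match excluded_middle_informative (exists b, B v m b) with
    | left h => fun n => proj1_sig (constructive_indefinite_description _ h) (cp m n)
    | right _ => zero end)) as [r hr].
  exists r; intros v b hv hb; specialize (hr v hv).
  destruct excluded_middle_informative as [h|none]; [|now destruct none; exists b].
  destruct constructive_indefinite_description as [b' hb']; simpl in hr.
  now rewrite (uniq v m b b'). }
destruct (choice _ H) as [r hr].
exists (join r); intros v m hv hB; apply (hr m v _ hv hB).
apply functional_extensionality; intro n; apply join_cp.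
Qed.

Definition pair_code (e : code) (n : nat) : nat := nat_of_list [nat_of_code e; n].

Lemma pair_code_inj e n e' n' : pair_code e n = pair_code e' n' -> e = e' /\ n = n'.
Proof. intro h; apply nat_of_list_inj in h; injection h as h%nat_of_code_inj; auto. Qed.

(** For fixed [v], [e] and [n] at most one [c] is bad: [e] computes at most one real from the bound
    of [v], and [A] and [tag] are injective. Index 0 handles distinctness from earlier labels. *)
Lemma choose_label {W : Type} (V : W -> Prop) (f : W -> real * real) A :
  independent A ->
  (forall h : W -> real, exists r, forall v, V v -> h v <> r) ->
  exists c, forall v, V v -> fst (f v) <> c /\
    forall n, ~ turing_le (A (tag c n)) (snd (f v)).
Proof.
intros ind small.
destruct (avoid_small V (fun v m c => m = 0 /\ fst (f v) = c \/
  exists e n, m = S (pair_code e n) /\ computes (snd (f v)) e (A (tag c n))))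
  as [c hc]; auto.
- intros v m b b' [[-> <-]|(e & n & -> & h)] [[h' <-]|(e' & n' & h' & h'')];
    try discriminate; auto.
  apply Nat.succ_inj, pair_code_inj in h' as [<- <-].
  pose proof (computes_functional _ _ _ _ h h'') as E.
  now apply independent_inj, tag_inj in E as [E _].
- exists c; intros v hv; split.
  + intro E; apply (hc v 0 hv); auto.
  + intros n [e he]; apply (hc v (S (pair_code e n)) hv); right; eauto.
Qed.

(** By the uniqueness in [upper_bounds], each [v], [e] and [n] rule out at most one parameter
    [r]. *)
Lemma choose_bound {W : Type} (V : W -> Prop) (c : W -> real) A (s : nat -> real) :
  independent A ->
  (forall h : W -> real, exists r, forall v, V v -> h v <> r) ->
  exists G, (forall i, turing_le (A (s i)) G) /\
    forall v n, V v -> (forall i, s i <> tag (c v) n) ->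
      ~ turing_le (A (tag (c v) n)) G.
Proof.
intros ind small; destruct (upper_bounds A s ind) as (G & h1 & h2).
destruct (avoid_small V (fun v m r => exists e n, m = pair_code e n /\
  (forall i, s i <> tag (c v) n) /\ computes (G r) e (A (tag (c v) n))))
  as [r hr]; auto.
- intros v m b b' (e & n & -> & h & h') (e' & n' & E & _ & h'').
  apply pair_code_inj in E as [<- <-]; eapply h2; eauto.
- exists (G r); split; auto; intros v n hv hs [e he].
  apply (hr v (pair_code e n) hv); eauto 6.
Qed.

Lemma down_set_enumeration {P : Type} (le : P -> P -> Prop) :
  (forall x, le x x) -> locally_countable le -> forall x,
  exists en : nat -> P, (forall i, le (en i) x) /\ forall y, le y x -> exists i, en i = y.
Proof.
intros refl lc x; destruct (lc x) as [f hf].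
(* [x] sits at index 0 and also fills the places outside the range of [f]. *)
pose (en := fun i => match i with
  | 0 => x
  | S i => match excluded_middle_informative (exists y, f y = i) with
           | left h => proj1_sig (proj1_sig (constructive_indefinite_description _ h))
           | right _ => x end
  end).
exists en; split.
- intros [|i]; simpl; auto; destruct excluded_middle_informative as [h|]; auto.
  destruct constructive_indefinite_description as [[y [hy ne]] E]; exact hy.
- intros y hy; destruct (classic (y = x)) as [->|ne]; [now exists 0|].
  pose (y' := exist (fun y => strict le y x) y (conj hy ne)).
  exists (S (f y')); simpl; destruct excluded_middle_informative as [h|no].
  + destruct constructive_indefinite_description as [z E]; simpl.
    now rewrite (hf _ _ E).
  + destruct no; now exists y'.
Qed.

(* Stage [w] picks a fresh label [c] for the elements first appearing below
   [p w], then an upper bound [G] for the reals attached to the elements below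
   [p w]; only the fewer than continuum many earlier choices must be avoided. *)
Lemma assignment {P : Type} (le : P -> P -> Prop) A :
  independent A -> partial_order le -> locally_countable le -> size_continuum P ->
  exists Z G : P -> real, forall x y, turing_le (A (Z y)) (G x) <-> le y x.
Proof.
intros ind (refl & _ & _) lc (j & jinj & jsurj).
destruct short_well_order as (W & lt & g & wf & tri & gsurj & small).
assert (exists p : W -> P, forall x, exists w, p w = x) as [p psurj].
{ destruct (choice _ jsurj) as [k hk]; exists (fun w => k (g w)); intro x.
  destruct (gsurj (j x)) as [w hw]; exists w; apply jinj; now rewrite hk. }
destruct (choice _ (down_set_enumeration le refl lc)) as [en hen].
(* [rho y] is the first stage whose element lies above [y], and [ix y] a place of [y] in the
   enumeration made there; together they determine [y]. *)
assert (exists rho : P -> W, forall y, le y (p (rho y)) /\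
  forall w, lt w (rho y) -> ~ le y (p w)) as [rho hrho].
{ apply (choice (fun y r => le y (p r) /\ forall w, lt w r -> ~ le y (p w))).
  intro y; apply (wf_min lt (fun w => le y (p w)) wf).
  destruct (psurj y) as [w <-]; exists w; apply refl. }
assert (exists ix : P -> nat, forall y, en (p (rho y)) (ix y) = y) as [ix hix].
{ apply (choice (fun y i => en (p (rho y)) i = y)); intro y; apply hen, hrho. }
assert (rho_le : forall w y, le y (p w) -> rho y = w \/ lt (rho y) w).
{ intros w y h; destruct (tri (rho y) w) as [|[|lw]]; auto.
  now destruct (proj2 (hrho y) w lw). }
pose (label := fun (c : W -> real) y => tag (c (rho y)) (ix y)).
(* At stage [w] the recursion has no value at [w] yet, so the new label is patched in. *)
pose (upd := fun (f : W -> real * real) w c v =>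
  if excluded_middle_informative (v = w) then c else fst (f v)).
(* In turn: the new label is fresh and no earlier bound computes a real tagged with it; the new
   bound lies above the reals it must; it computes no other real tagged with an earlier label. *)
pose (stage := fun w (f : W -> real * real) (cG : real * real) =>
  (forall v, lt v w -> fst (f v) <> fst cG /\
     forall n, ~ turing_le (A (tag (fst cG) n)) (snd (f v))) /\
  (forall i, turing_le (A (label (upd f w (fst cG)) (en (p w) i))) (snd cG)) /\
  forall v n, lt v w ->
    (forall i, label (upd f w (fst cG)) (en (p w) i) <> tag (fst (f v)) n) ->
    ~ turing_le (A (tag (fst (f v)) n)) (snd cG)).
destruct (transfinite_choice lt (zero, zero) stage wf) as [f hf].
{ intros w f.
  destruct (choose_label (fun v => lt v w) f A ind (small w)) as [c hc].
  destruct (choose_bound (fun v => lt v w) (fun v => fst (f v)) A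
    (fun i => label (upd f w c) (en (p w) i)) ind (small w)) as (G & h1 & h2).
  exists (c, G); repeat split; auto; now apply hc. }
{ intros w f f' [c G] E (h1 & h2 & h3); cbn [fst snd] in *.
  assert (L : forall i, label (upd f w c) (en (p w) i) = label (upd f' w c) (en (p w) i)).
  { intro i; unfold label, upd; destruct excluded_middle_informative as [|ne]; auto.
    rewrite E; auto; destruct (rho_le w (en (p w) i)); [apply hen | easy | easy]. }
  repeat split; cbn [fst snd] in *.
  - rewrite <- E by auto; now apply h1.
  - rewrite <- E by auto; now apply h1.
  - intro i; rewrite <- L; apply h2.
  - intros v n lv; rewrite <- E by auto; intro h; apply h3; auto.
    intro i; rewrite L; apply h. }
pose (Z := label (fun v => fst (f v))).
assert (updE : forall w, upd f w (fst (f w)) = fun v => fst (f v)).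
{ intro w; apply functional_extensionality; intro v; unfold upd.
  destruct excluded_middle_informative; congruence. }
assert (Zinj : forall y y', Z y = Z y' -> y = y').
{ intros y y' [E1 E2]%tag_inj; rewrite <- (hix y), <- (hix y'), E2.
  replace (rho y') with (rho y); auto.
  destruct (tri (rho y) (rho y')) as [l|[|l]]; auto; exfalso.
  - now apply (proj1 (hf _) _ l).
  - now apply (proj1 (hf _) _ l). }
destruct (choice _ psurj) as [sigma hsigma].
exists Z, (fun x => snd (f (sigma x))); intros x y.
destruct (hf (sigma x)) as (h1 & h2 & h3); rewrite updE, hsigma in *.
split.
- intro le_T; apply NNPP; intro nle.
  (* The label of [y] was chosen before, together with or after the bound of [x]. The third and the
     first clause of [stage] settle the outer cases; in the middle one [y] lies below [x] by the
     choice of [rho]. *)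
  destruct (tri (rho y) (sigma x)) as [l|[E|l]].
  + apply (h3 (rho y) (ix y) l); auto; intros i E.
    apply nle; rewrite <- (Zinj (en x i) y E); apply hen.
  + apply nle; rewrite <- (hsigma x), <- E; apply hrho.
  + now apply (proj2 (proj1 (hf (rho y)) _ l) (ix y)).
- intro h; destruct (proj2 (hen x) y h) as [i <-]; apply h2.
Qed.

(** * The embedding *)

Definition degree (A : real) : tdegree :=
  exist _ (fun B => turing_equiv B A)
    (ex_intro _ A (fun B => conj (fun h => h) (fun h => h))).

Lemma degree_le A B : tdeg_le (degree A) (degree B) <-> turing_le A B.
Proof.
split.
- intros (A' & B' & [_ h1] & [h2 _] & h); simpl in *.
  eapply turing_le_trans; [exact h1|]; eapply turing_le_trans; eauto.
- intro h; exists A, B; repeat split; auto using turing_le_refl.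
Qed.

Lemma height2_no_chain3 {P : Type} (le : P -> P -> Prop) x y z :
  partial_order le -> height le 2 -> strict le x y -> ~ strict le y z.
Proof.
intros (_ & anti & trans) [_ no] [h1 n1] [h2 n2]; apply no.
exists (fun i => match i with 0 => x | 1 => y | _ => z end).
intros [|[|i]] [|[|[|k]]] hi hk; try lia; split; eauto.
intros ->; apply n1; auto.
Qed.

Theorem theorem1p1 (P : Type) (le : P -> P -> Prop) :
  partial_order le ->
  locally_countable le ->
  size_continuum P ->
  height le 2 ->
  embeds_into_degrees le.
Proof.
intros po lc sc ht; destruct independent_family as [A ind].
destruct (assignment le A ind po lc sc) as (Z & G & H).
pose proof po as (refl & anti & _).
pose (f := fun x => if excluded_middle_informative (exists y, strict le y x)
  then G x else A (Z x)).
assert (f_up : forall x, turing_le (f x) (G x)).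
{ intro x; unfold f; destruct excluded_middle_informative;
    [apply turing_le_refl | now apply H]. }
assert (f_low : forall x, turing_le (A (Z x)) (f x)).
{ intro x; unfold f; destruct excluded_middle_informative;
    [now apply H | apply turing_le_refl]. }
assert (f_le : forall x y, le x y <-> turing_le (f x) (f y)).
{ intros x y; split.
  - intro h; destruct (classic (x = y)) as [->|ne]; [apply turing_le_refl|].
    assert (hs : strict le x y) by now split.
    (* By height two [x] is minimal, while [y] is not: [f x] is [A (Z x)] and [f y] is [G y]. *)
    unfold f; destruct excluded_middle_informative as [[w hw]|_].
    + now destruct (height2_no_chain3 le w x y).
    + destruct excluded_middle_informative as [_|no]; [now apply H|].
      destruct no; eauto.
  - intro h; apply H.
    eapply turing_le_trans; [apply f_low|]; eapply turing_le_trans; eauto. }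
exists (fun x => degree (f x)); split.
- intros x y E.
  apply anti; apply f_le, degree_le; rewrite E; apply degree_le, turing_le_refl.
- intros x y; rewrite degree_le; apply f_le.
Qed.
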